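(* Consider a graph $\overline X=(V,E)$ and let $G=\pi_1(\overline X;G_v,A_e)$ be the fundamental group of a graph of groups. Choose a maximal subtree $T=(V,E_T)\subset\overline X$, and let $S=E\setminus E_T$ be the collection of oriented edges not in $T$. Then any action of $G$ on a set $\Omega$ which admits a proper interactive family for $(G_v,A_e)$ is faithful.
   Context: Graphs of groups. $\overline X=(V,E)$ is a connected graph, $E$ is the set of oriented edges, $o(e),t(e)\in V$ are the origin and target of $e$, and $\overline e$ is $e$ with reversed orientation. A graph of groups has vertex groups $G_v$, edge groups $A_e=A_{\overline e}$ and boundary injections $\alpha_e:A_e\to G_{o(e)}$, $\omega_e:A_e\to G_{t(e)}$ (with $\alpha_{\overline e}=\omega_e$). Its fundamental group, with respect to the spanning tree $T$, is $$G=\langle G_v\ (v\in V),\,E \mid \mathrm{rel}(G_v),\ \overline e=e^{-1}\ (e\in E),\ e=\mathrm{id}\ (e\in E_T),\ e^{-1}\alpha_e(g)e=\omega_e(g)\ (e\in E,\,g\in A_e)\rangle,$$ where $\mathrm{rel}(G_v)$ are the relations of $G_v$. The vertex groups are identified with subgroups of $G$, and $s\in S$ also denotes the corresponding element of $G$ (so $\overline s=s^{-1}$). Notation. $\mathrm{St}_T(v)=\{e\in E_T: o(e)=v\}$; for $e\in E_T$, $v\in V$, write $v\in C(e,T)$ if $e$ belongs to the oriented geodesic path in $T$ from $o(e)$ to $v$. Interactive family. Given an action of $G$ on a set $\Omega$, a family of subsets $\boxminus=\{X_v,Z_s\}_{v\in V,s\in S}$ of $\Omega$ is an interactive family if: (IF1)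 the subsets $X_v,Z_s$ are pairwise disjoint; the $Z_s$ are non-empty; and if $G_v\ne\alpha_e(A_e)$ for some $e\in E$ with $o(e)=v$, then $X_v\neq\emptyset$; (IF2) $s(O)\subset Z_s$ for every $s\in S$ and $O\in\boxminus\setminus\{Z_{\overline s}\}$; (IF3) $\alpha_s(A_s)(Z_s)\subset Z_s$ for every $s\in S$; (IF4) $(G_{o(s)}\setminus\alpha_s(A_s))(Z_s)\subset X_{o(s)}$ for every $s\in S$; (IF5) for $v\in V$ and $e\in\mathrm{St}_T(v)$ with $G_v\ne\alpha_e(A_e)$, $X_v$ contains a (specified) non-empty subset $X_v^e$; (IF6) $\alpha_e(A_e)(X_{o(e)}^e)\subset X_{o(e)}^e$ for every $e\in E_T$; (IF7) if $e\in E_T$ and $v\in V$ satisfy $v\in C(e,T)$, then $(G_{o(e)}\setminus\alpha_e(A_e))(X_v)\subset X^e_{o(e)}$; (IF8) if $e\in E_T$ and $s\in S$ satisfy $o(s)\in C(e,T)$, then $(G_{o(e)}\setminus\alpha_e(A_e))(Z_s)\subset X^e_{o(e)}$. (Conditions mentioning $X^e_{o(e)}$ are understood for those $e$ for which it has been specified.) It is proper if moreover: (IF9) for $s\in S$ the action of $\alpha_s(A_s)$ restricted to $Z_s$ is faithful, and for $e\in E_T$ the action of $\alpha_e(A_e)$ restricted to $X^e_{o(e)}$ is faithful; (IF10) if $X_v\ne\emptyset$ for some $v\in V$, then there is a (possibly different) $w\in V$ such that the union of all the images appearing in (IF4), (IF7), (IF8) inside $X_w$ (those with $o(s)=w$,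 resp. $o(e)=w$) misses a point of $X_w$; (IF11) if $S=\{s,\overline s\}$ and $X_v=\emptyset$ for every $v\in V$, then there is $p\in\Omega\setminus(Z_s\cup Z_{\overline s})$ with $s(p)\in Z_s$ and $\overline s(p)\in Z_{\overline s}$.
   Formalization: The formal statement excludes the degenerate case where S is empty (the graph is a tree) and some vertex group is all of G; there the claim can fail, e.g. one vertex, no edges, X_v empty, any action of G_v. *)

(* Defs.v *)
From HB Require Import structures.
From mathcomp Require Import all_boot generic_quotient.
From mathcomp Require Import boolp classical_sets.

Set Implicit Arguments.
Unset Strict Implicit.
Unset Printing Implicit Defensive.

Local Open Scope classical_set_scope.
Local Open Scope group_scope.
Local Open Scope quotient_scope.

(* A pair (x, b) stands for the generator x when b = false and for its        *)
(* inverse when b = true; R u v is the relation u = v.                        *)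
Section Presentation.
Variables (X : choiceType) (R : seq (X * bool) -> seq (X * bool) -> Prop).
Implicit Types u v w : seq (X * bool).

Definition winv w : seq (X * bool) := rev [seq (a.1, ~~ a.2) | a <- w].

Inductive wcong : seq (X * bool) -> seq (X * bool) -> Prop :=
| wcong_refl w : wcong w w
| wcong_sym u v : wcong u v -> wcong v u
| wcong_trans v u w : wcong u v -> wcong v w -> wcong u w
| wcong_cat u u' v v' : wcong u u' -> wcong v v' -> wcong (u ++ v) (u' ++ v')
| wcong_cancel x b : wcong [:: (x, b); (x, ~~ b)] [::]
| wcong_rel u v : R u v -> wcong u v.

Definition wcongb u v : bool := `[< wcong u v >].

Fact wcongb_refl : reflexive wcongb.
Proof. by move=> w; apply/asboolP; exact: wcong_refl. Qed.

Fact wcongb_sym : symmetric wcongb.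
Proof. by move=> u v; apply/asboolP/asboolP; exact: wcong_sym. Qed.

Fact wcongb_trans : transitive wcongb.
Proof.
by move=> v u w /asboolP uv /asboolP vw; apply/asboolP; exact: wcong_trans vw.
Qed.

Canonical wcong_equiv := EquivRel wcongb wcongb_refl wcongb_sym wcongb_trans.

Definition presented := {eq_quot wcong_equiv}.
HB.instance Definition _ := Choice.on presented.
HB.instance Definition _ := EqQuotient.on presented.

Definition wclass u : presented := (\pi_presented u)%qT.

Lemma wclassP u v : wclass u = wclass v <-> wcong u v.
Proof.
split=> [/eqmodP/asboolP//|uv]; apply/eqmodP; exact/asboolP.
Qed.

Lemma wclassK (a : presented) : wclass (repr a) = a.
Proof. exact: reprK. Qed.

Lemma winv_cat u v : winv (u ++ v) = winv v ++ winv u.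
Proof. by rewrite /winv map_cat rev_cat. Qed.

Lemma winvK : involutive winv.
Proof.
move=> w; rewrite /winv map_rev revK -map_comp -[RHS]map_id.
by apply: eq_map => -[x b] /=; rewrite negbK.
Qed.

Lemma wcong_mulrV w : wcong (w ++ winv w) [::].
Proof.
elim/last_ind: w => [|w [x b] IHw]; first exact: wcong_refl.
rewrite -cats1 winv_cat -catA [X in _ ++ X]catA.
apply: wcong_trans IHw; apply: wcong_cat; first exact: wcong_refl.
rewrite -[X in wcong _ X]cat0s; apply: wcong_cat; last exact: wcong_refl.
exact: wcong_cancel.
Qed.

Lemma wcong_mulV w : wcong (winv w ++ w) [::].
Proof. by rewrite -{2}[w]winvK; exact: wcong_mulrV. Qed.

Lemma wcong_winv u v : wcong u v -> wcong (winv u) (winv v).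
Proof.
move=> uv; apply: (@wcong_trans (winv u ++ (v ++ winv v))).
  rewrite -[X in wcong X _]cats0; apply: wcong_cat; first exact: wcong_refl.
  exact/wcong_sym/wcong_mulrV.
rewrite catA -[X in wcong _ X]cat0s; apply: wcong_cat; last exact: wcong_refl.
apply: wcong_trans (wcong_mulV u); apply: wcong_cat; first exact: wcong_refl.
exact: wcong_sym.
Qed.

Definition pmul (a b : presented) : presented := wclass (repr a ++ repr b).
Definition pone : presented := wclass [::].
Definition pinv (a : presented) : presented := wclass (winv (repr a)).

Lemma pmulE u v : pmul (wclass u) (wclass v) = wclass (u ++ v).
Proof. by apply/wclassP; apply: wcong_cat; apply/wclassP; exact: wclassK. Qed.

Lemma pinvE u : pinv (wclass u) = wclass (winv u).
Proof. by apply/wclassP/wcong_winv/wclassP; exact: wclassK. Qed.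

Fact pmulA : associative pmul.
Proof.
move=> a b c; rewrite -(wclassK a) -(wclassK b) -(wclassK c).
by rewrite !pmulE catA.
Qed.

Fact pmul1 : left_id pone pmul.
Proof. by move=> a; rewrite -(wclassK a) /pone pmulE. Qed.

Fact pmulr1 : right_id pone pmul.
Proof. by move=> a; rewrite -(wclassK a) /pone pmulE cats0. Qed.

Fact pmulV : left_inverse pone pinv pmul.
Proof.
move=> a; rewrite -(wclassK a) pinvE pmulE; apply/wclassP; exact: wcong_mulV.
Qed.

Fact pmulrV : right_inverse pone pinv pmul.
Proof.
move=> a; rewrite -(wclassK a) pinvE pmulE; apply/wclassP.
exact: wcong_mulrV.
Qed.

HB.instance Definition _ :=
  isGroup.Build presented pmulA pmul1 pmulr1 pmulV pmulrV.

End Presentation.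

(* A graph in the sense of Serre: edge is the set of oriented edges.          *)
Record graph := Graph {
  vertex : choiceType;
  edge : choiceType;
  org : edge -> vertex;
  rev_edge : edge -> edge;
  rev_edgeK : involutive rev_edge;
  rev_edge_neq : forall e, rev_edge e != e
}.

Definition tgt (X : graph) (e : edge X) : vertex X := org (rev_edge e).

Fixpoint epath (X : graph) (D : set (edge X)) (u : vertex X)
    (p : seq (edge X)) (v : vertex X) : Prop :=
  if p is e :: q then [/\ D e, org e = u & epath D (tgt e) q v] else u = v.

Definition connected_graph (X : graph) (D : set (edge X)) : Prop :=
  inhabited (vertex X) /\ forall u v : vertex X, exists p, epath D u p v.

(* The clause on consecutive edges only matters for circuits of length 2. *)
Definition circuit (X : graph) (D : set (edge X)) (p : seq (edge X)) : Prop :=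
  [/\ p <> [::], exists v, epath D v p v,
      sorted (fun e f => f != rev_edge e) p & uniq (map (@org X) p)].

Definition spanning_tree (X : graph) (D : set (edge X)) : Prop :=
  [/\ forall e, D e -> D (rev_edge e), connected_graph D &
      ~ exists p, circuit D p].

Definition geodesic (X : graph) (D : set (edge X)) (u : vertex X)
    (p : seq (edge X)) (v : vertex X) : Prop :=
  epath D u p v /\ forall q, epath D u q v -> size p <= size q.

(* v \in C(e, T), for T the tree with edge set D *)
Definition beyond (X : graph) (D : set (edge X)) (e : edge X) (v : vertex X) :
    Prop :=
  exists2 p, geodesic D (org e) p v & e \in p.

(* Only alpha is part of the data: as alpha_(rev e) = omega_e, omega is       *)
(* recovered from alpha through the identification A_(rev e) = A_e.           *)
Record graph_of_groups (X : graph) := GraphOfGroups {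
  vgroup : vertex X -> groupType;
  egroup : edge X -> groupType;
  egroup_rev : forall e, egroup e = egroup (rev_edge e);
  alpha : forall e, {multiplicative egroup e -> vgroup (org e)};
  alpha_inj : forall e, injective (alpha e)
}.

Definition omega (X : graph) (GG : graph_of_groups X) (e : edge X)
    (a : egroup GG e) : vgroup GG (tgt e) :=
  alpha GG (rev_edge e) (ecast A (Group.sort A) (egroup_rev GG e) a).

Section FundamentalGroup.
Variables (X : graph) (GG : graph_of_groups X) (ET : set (edge X)).

Definition pi1_gen : choiceType :=
  ({v : vertex X & vgroup GG v} + edge X)%type.

Definition gen_v (v : vertex X) (g : vgroup GG v) : pi1_gen * bool :=
  (inl (existT _ v g), false).
Definition gen_e (e : edge X) : pi1_gen * bool := (inr e, false).
Definition gen_eV (e : edge X) : pi1_gen * bool := (inr e, true).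

Inductive pi1_rel : seq (pi1_gen * bool) -> seq (pi1_gen * bool) -> Prop :=
| pi1_vgroup v (g h : vgroup GG v) :
    pi1_rel [:: gen_v g; gen_v h] [:: gen_v (g * h)]
| pi1_rev e : pi1_rel [:: gen_e (rev_edge e)] [:: gen_eV e]
| pi1_tree e : ET e -> pi1_rel [:: gen_e e] [::]
| pi1_edge e (a : egroup GG e) :
    pi1_rel [:: gen_eV e; gen_v (alpha GG e a); gen_e e] [:: gen_v (omega a)].

Definition pi1 : groupType := presented pi1_rel.

Definition vincl (v : vertex X) (g : vgroup GG v) : pi1 :=
  wclass pi1_rel [:: gen_v g].
Definition eincl (e : edge X) : pi1 := wclass pi1_rel [:: gen_e e].

End FundamentalGroup.

Record left_action (G : groupType) (Omega : Type) := LeftAction {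
  lact :> G -> Omega -> Omega;
  lact1 : forall x, lact 1 x = x;
  lactM : forall g h x, lact (g * h) x = lact g (lact h x)
}.

Definition faithful_action (G : groupType) (Omega : Type)
    (rho : left_action G Omega) : Prop :=
  forall g, (forall x, rho g x = x) -> g = 1.

(* S is the complement of ET. Z s is only relevant for s in S, and Xe e       *)
(* (which is X_v^e, for v = org e) only for e in ET with G_v <> alpha_e(A_e). *)
(* Elements of the vertex groups act through vincl.                           *)
Section InteractiveFamily.
Variables (X : graph) (GG : graph_of_groups X) (ET : set (edge X)).
Variables (Omega : Type) (rho : left_action (pi1 GG ET) Omega).
Variables (Xv : vertex X -> set Omega) (Z : edge X -> set Omega).
Variables (Xe : edge X -> set Omega).

Local Notation S := (~` ET).

(* alpha_e(A_e) *)
Definition ealpha (e : edge X) : set (vgroup GG (org e)) := range (alpha GG e).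
Arguments ealpha e : clear implicits.

Definition eproper (e : edge X) : Prop := setT <> ealpha e.

Definition vmove (v : vertex X) (H : set (vgroup GG v)) (O : set Omega) :
    set Omega :=
  [set rho (vincl ET g) x | g in H & x in O].

Definition emove (e : edge X) (O : set Omega) : set Omega :=
  [set rho (eincl GG ET e) x | x in O].

Definition faithful_on (v : vertex X) (H : set (vgroup GG v))
    (O : set Omega) : Prop :=
  forall g, H g -> (forall x, O x -> rho (vincl ET g) x = x) -> g = 1.

Record interactive : Prop := Interactive {
  IF1_XX : trivIset setT Xv;
  IF1_ZZ : trivIset S Z;
  IF1_XZ : forall v s, S s -> Xv v `&` Z s = set0;
  IF1_Z : forall s, S s -> Z s !=set0;
  IF1_X : forall e, eproper e -> Xv (org e) !=set0;
  IF2_X : forall s v, S s -> emove s (Xv v) `<=` Z s;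
  IF2_Z : forall s r, S s -> S r -> r <> rev_edge s ->
    emove s (Z r) `<=` Z s;
  IF3 : forall s, S s -> vmove (ealpha s) (Z s) `<=` Z s;
  IF4 : forall s, S s -> vmove (~` ealpha s) (Z s) `<=` Xv (org s);
  IF5 : forall e, ET e -> eproper e -> Xe e !=set0 /\ Xe e `<=` Xv (org e);
  IF6 : forall e, ET e -> eproper e -> vmove (ealpha e) (Xe e) `<=` Xe e;
  IF7 : forall e v, ET e -> eproper e -> beyond ET e v ->
    vmove (~` ealpha e) (Xv v) `<=` Xe e;
  IF8 : forall e s, ET e -> eproper e -> S s -> beyond ET e (org s) ->
    vmove (~` ealpha e) (Z s) `<=` Xe e
}.

(* the union of the images occurring in IF4, IF7 and IF8 inside X_w *)
Definition if_images (w : vertex X) : set Omega :=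
  [set p | (exists s, [/\ S s, org s = w & vmove (~` ealpha s) (Z s) p]) \/
    (exists e v, [/\ ET e, org e = w, beyond ET e v &
       vmove (~` ealpha e) (Xv v) p]) \/
    (exists e s, [/\ ET e, org e = w, S s, beyond ET e (org s) &
       vmove (~` ealpha e) (Z s) p])].

Record proper_interactive : Prop := ProperInteractive {
  proper_IF : interactive;
  IF9_Z : forall s, S s -> faithful_on (ealpha s) (Z s);
  IF9_X : forall e, ET e -> eproper e -> faithful_on (ealpha e) (Xe e);
  IF10 : (exists v, Xv v !=set0) ->
    exists w p, Xv w p /\ ~ if_images w p;
  IF11 : forall s, S = [set s; rev_edge s] -> (forall v, Xv v = set0) ->
    exists p, [/\ ~ Z s p, ~ Z (rev_edge s) p,
      Z s (rho (eincl GG ET s) p) &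
      Z (rev_edge s) (rho (eincl GG ET (rev_edge s)) p)]
}.

End InteractiveFamily.

(* Degenerate decompositions: the graph is a tree and a single vertex group   *)
(* is already the whole group. They have to be excluded, because then the     *)
(* conditions may hold for an action which is not faithful. Example: a        *)
(* segment with vertices v, w and groups G_v = A_e = 1, G_w = Z/2, acting on  *)
(* a one-point set Omega with X_w = X_w^e = Omega and X_v empty. Even simpler *)
(* is a single vertex without edges, for which all conditions are vacuous.    *)
(* If S is non-empty, nothing is excluded.                                    *)
Definition trivial_splitting (X : graph) (GG : graph_of_groups X)
    (ET : set (edge X)) : Prop :=
  ET = setT /\ exists v, range (@vincl X GG ET v) = setT.

(* Main.v *)
Require Import Defs.
From mathcomp Require Import all_boot boolp classical_sets.

(** The proof is a ping-pong argument.  The group is generated by the vertex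
groups and the edges s outside the tree, so the task is to show that a
non-trivial element moves some point, and for this it is enough to write each
element as a product of generators whose successive factors can be followed
through the sets of the interactive family.

Inside the tree a single fact does all the work ([push_vertex]).  An element x
of G_v, carried along the geodesic from v to u, either lies in every edge group
that it meets, and then it is also an element of G_u, or it gets stuck: it is
an element of G_(o(e)) outside alpha_e(A_e) for an edge e that points to u.
In the second case (IF7) and (IF8) say where x sends the set attached to u.

Call the formal symbols X_v and Z_s states.  Pushing each factor towards the
state reached by the factors on its right, and merging or cancelling whatever
can be, turns a word of length n into k h ([word_normal_form]).  Here k is a
product of at most n factors each of which maps the set of the current state
into the set of the next one, and h belongs to the stabilizer of the initial
state B, that is, to G_v if B is X_v and to alpha_s(A_s) if B is Z_s.  When h
is not 1, k has at most n - 1 factors, so that the length of the word does not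
increase.  One obstruction is left: if B is Z_s, the word may end in the
inverse of s, the letter for which (IF2) says nothing on Z_s.

Let g act trivially.  Assume first that some edge lies outside the tree, and
take a word of minimal length for g.  If g = k s with k shorter, the normal
form of k relative to Z_s has no obstruction by minimality, so that g maps
every point q with s q in Z_s into the set of one fixed state; such a point
exists outside any prescribed set of the family ([escape_point]; (IF11) serves
for the case of a single pair of sets Z_s), a contradiction.  In general, the
normal form of g relative to Z_s shows that either g is in alpha_s(A_s), and
(IF9) applies, or g starts with s.  In the latter case the previous argument
applies to the inverse of g ([kernel_edge]).

If the tree is everything, (IF10) gives a point p of some X_w outside all the
images in X_w.  A reduced product of at least one factor that starts from X_w
moves p: it sends p into another set or into one of the images.  A conjugate
of g of minimal length k h has h = 1, or else can be replaced with h k, which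
is reduced by minimality; so k = 1, and g is conjugate to an element of G_w
([kernel_conj_vertex]).
As the splitting is not trivial, some edge f pointing to w has
alpha_f(A_f) <> G_(o(f)), so that X_(o(f)) is not empty.  An element of G_w
which fixes it pointwise cannot get stuck on its way to o(f), hence it lies in
the edge group of f, and (IF9) applies again ([kernel_vertex]). *)

Set Implicit Arguments.
Unset Strict Implicit.
Unset Printing Implicit Defensive.

Local Open Scope classical_set_scope.
Local Open Scope group_scope.

Lemma minimal_nat (P : nat -> Prop) :
  (exists n, P n) -> exists2 n, P n & forall m, P m -> n <= m.
Proof.
move=> exP; have exPb : exists n, `[< P n >].
  by have [n Pn] := exP; exists n; apply/asboolP.
case: (ex_minnP exPb) => n /asboolP Pn min_n.
by exists n => // m Pm; apply/min_n/asboolP.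
Qed.

(** * Geodesics *)

Section Geodesics.
Variables (X : graph) (D : set (edge X)).
Implicit Types (u v w : vertex X) (e f : edge X) (p q : seq (edge X)).

Lemma epath_cat u p q w :
  epath D u (p ++ q) w <-> exists2 v, epath D u p v & epath D v q w.
Proof.
elim: p u => [|e p IHp] u /=; first by split=> [|[v <-]] //; exists u.
split=> [[De eu /IHp[v ? ?]]|[v [De eu epv] vqw]]; first by exists v.
by split=> //; apply/IHp; exists v.
Qed.

Lemma epath_rev u p v : (forall e, D e -> D (rev_edge e)) ->
  epath D u p v -> epath D v (rev (map (@rev_edge X) p)) u.
Proof.
move=> symD; elim: p u => [|e p IHp] u /= => [->|[De eu /IHp vpe]] //.
rewrite rev_cons -cats1; apply/epath_cat; exists (tgt e) => //=.
by split=> //; [exact: symD | rewrite /tgt rev_edgeK].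
Qed.

Lemma geodesic_exists u v : connected_graph D -> exists p, geodesic D u p v.
Proof.
move=> [_ /(_ u v)[p0 Dp0]].
have [|n [p Dp <-] min_p] := minimal_nat (P := fun n =>
    exists2 p, epath D u p v & size p = n).
  by exists (size p0), p0.
by exists p; split=> // q Dq; apply: min_p; exists q.
Qed.

Lemma geodesic_rev u p v : (forall e, D e -> D (rev_edge e)) ->
  geodesic D u p v -> geodesic D v (rev (map (@rev_edge X) p)) u.
Proof.
move=> symD [Dp min_p].
split=> [|q /(epath_rev symD)/min_p]; first exact: epath_rev.
by rewrite !size_rev !size_map.
Qed.

Lemma geodesic_behead u e q v :
  geodesic D u (e :: q) v -> geodesic D (tgt e) q v.
Proof.
move=> [[De eu Dq] min_q]; split=> // r Dr.
by have := min_q (e :: r); apply.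
Qed.

(** The part of a geodesic from the origin of f that precedes f is a closed path,
which could be cut out. *)
Lemma geodesic_head f p v : geodesic D (org f) p v -> f \in p ->
  exists q, p = f :: q.
Proof.
move=> [Dp min_p] f_p; move: Dp min_p; case/splitPr: p / f_p => p1 p2.
case: p1 => [|e p1]; first by exists p2.
case/epath_cat=> u _ /= [Df fu Dp2] min_p.
have /min_p : epath D (org f) (f :: p2) v by [].
by rewrite /= size_cat /= ltnS leqNgt ltn_addl.
Qed.

Lemma epath_last u e p v : epath D u (e :: p) v ->
  D (last e p) /\ tgt (last e p) = v.
Proof. by elim: p u e => [|f p IHp] u e /= [De _] => [->|/IHp]. Qed.

(** The geodesic from a vertex to itself is empty. *)
Lemma beyond_neq e v : beyond D e v -> v <> org e.
Proof.
move=> [p [_ min_p] ep] ve.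
by move: (min_p [::] (esym ve)) ep; case: p {min_p}.
Qed.

End Geodesics.

(** * Generators of the fundamental group *)

Section Pi1.
Variables (X : graph) (GG : graph_of_groups X) (ET : set (edge X)).
Local Notation G := (pi1 GG ET).
Local Notation edg := (eincl GG ET).

Lemma wclassM u v :
  wclass (@pi1_rel X GG ET) (u ++ v) = wclass _ u * wclass _ v :> G.
Proof. by rewrite -pmulE. Qed.

Lemma wclassV u :
  wclass (@pi1_rel X GG ET) (winv u) = (wclass _ u : G)^-1.
Proof. by rewrite -pinvE. Qed.

Lemma wclass_nil : wclass (@pi1_rel X GG ET) [::] = 1 :> G.
Proof. by []. Qed.

Lemma vinclM v : {morph @vincl X GG ET v : g h / g * h}.
Proof.
by move=> g h; rewrite -wclassM; apply/esym/wclassP/wcong_rel/pi1_vgroup.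
Qed.

Lemma vincl1 v : @vincl X GG ET v 1 = 1.
Proof. by apply: (@mulgI _ (@vincl X GG ET v 1)); rewrite -vinclM !mulg1. Qed.

Lemma vinclV v : {morph @vincl X GG ET v : g / g^-1}.
Proof. by move=> g; apply/esym/mulg1_eq; rewrite -vinclM mulgV vincl1. Qed.

Lemma eincl_inv e : wclass _ [:: gen_eV GG e] = (edg e)^-1.
Proof. by rewrite -wclassV. Qed.

Lemma eincl_rev e : edg (rev_edge e) = (edg e)^-1.
Proof. by rewrite -eincl_inv; apply/wclassP/wcong_rel/pi1_rev. Qed.

Lemma eincl_tree e : ET e -> edg e = 1.
Proof. by move=> Te; rewrite -wclass_nil; apply/wclassP/wcong_rel/pi1_tree. Qed.

Lemma eincl_conj e (a : egroup GG e) :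
  vincl ET (alpha GG e a) * edg e = edg e * vincl ET (omega a).
Proof.
have -> : vincl ET (omega a) = (edg e)^-1 * vincl ET (alpha GG e a) * edg e.
  rewrite {1}/vincl; have /wcong_rel/wclassP <- := pi1_edge ET a.
  by rewrite -eincl_inv -[_ :: _]/([:: _] ++ [:: _] ++ [:: _]) !wclassM mulgA.
by rewrite -mulgA mulVKg.
Qed.

(** Everything below takes place in subsets of the fundamental group, which
removes the dependency of the vertex and edge groups on vertices and edges. *)
Definition vsub v : set G := range (@vincl X GG ET v).
Definition esub e : set G := @vincl X GG ET (org e) @` range (alpha GG e).

Lemma vsub1 v : vsub v 1.
Proof. by exists 1 => //; exact: vincl1. Qed.

Lemma vsubM v x y : vsub v x -> vsub v y -> vsub v (x * y).
Proof. by move=> [g _ <-] [h _ <-]; exists (g * h) => //; exact: vinclM. Qed.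

Lemma vsubV v x : vsub v x -> vsub v x^-1.
Proof. by move=> [g _ <-]; exists g^-1 => //; exact: vinclV. Qed.

Lemma esub1 e : esub e 1.
Proof.
exists 1; last exact: vincl1.
by exists 1 => //; apply: (@mulgI _ (alpha GG e 1)); rewrite -gmulfM !mulg1.
Qed.

Lemma esubM e x y : esub e x -> esub e y -> esub e (x * y).
Proof.
move=> [_ [a _ <-] <-] [_ [b _ <-] <-]; exists (alpha GG e (a * b)).
  by exists (a * b).
by rewrite gmulfM vinclM.
Qed.

Lemma esub_vsub e x : esub e x -> vsub (org e) x.
Proof. by move=> [g _ <-]; exists g. Qed.

(** The relation of the edge e, read as a rule to carry an element of an edge
group across e from left to right. *)
Lemma esub_edge e x : esub e x ->
  exists2 y, esub (rev_edge e) y & x * edg e = edg e * y.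
Proof.
move=> [_ [a _ <-] <-]; exists (vincl ET (omega a)); last exact: eincl_conj.
by exists (omega a) => //; rewrite /omega; eexists.
Qed.

Lemma esub_tree e x : ET e -> esub e x -> esub (rev_edge e) x.
Proof.
by move=> Te /esub_edge[y]; rewrite (eincl_tree Te) mulg1 mul1g => + ->.
Qed.

End Pi1.

Arguments vsub {X} GG ET v.
Arguments esub {X} GG ET e.

Section NormalForms.
Variables (X : graph) (GG : graph_of_groups X) (ET : set (edge X)).
Hypotheses (symT : forall e, ET e -> ET (rev_edge e))
  (conT : connected_graph ET).
Local Notation G := (pi1 GG ET).
Local Notation edg := (eincl GG ET).
Local Notation vsub := (vsub GG ET).
Local Notation esub := (esub GG ET).

Lemma rev_notin_tree s : ~ ET s -> ~ ET (rev_edge s).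
Proof. by move=> Ss /symT; rewrite rev_edgeK. Qed.

(** * Words in the vertex groups and the edges outside the tree *)

(** Every factor counts for 1 in the length, so that elements of one vertex group
that become adjacent merge into a shorter word. *)
Inductive word : nat -> G -> Prop :=
| word_nil : word 0 1
| word_vertex n v x g : vsub v x -> word n g -> word n.+1 (x * g)
| word_edge n s g : ~ ET s -> word n g -> word n.+1 (edg s * g).

Lemma word_cat m n g h : word m g -> word n h -> word (m + n) (g * h).
Proof.
move=> wg wh.
elim: wg => [|k v x k' vx _ IH|k s k' Ss _ IH]; first by rewrite mul1g.
  by rewrite -mulgA; exact: word_vertex vx IH.
by rewrite -mulgA; exact: word_edge Ss IH.
Qed.

Lemma word_vsub v x : vsub v x -> word 1%N x.
Proof. by move=> vx; rewrite -[x]mulg1; exact: word_vertex vx word_nil. Qed.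

Lemma word_edg s : ~ ET s -> word 1%N (edg s).
Proof. by move=> Ss; rewrite -[edg s]mulg1; exact: word_edge Ss word_nil. Qed.

Lemma word_inv n g : word n g -> word n g^-1.
Proof.
elim=> [|k v x h vx _ IH|k s h Ss _ IH].
- by rewrite invg1; exact: word_nil.
- by rewrite invgM -addn1; apply: word_cat IH _; apply: word_vsub (vsubV vx).
- rewrite invgM -addn1; apply: word_cat IH _; rewrite -eincl_rev.
  exact/word_edg/rev_notin_tree.
Qed.

Lemma word_exists g : exists n, word n g.
Proof.
rewrite -(wclassK g); elim: (repr g) => [|a w [n wn]].
  by exists 0; exact: word_nil.
rewrite -cat1s wclassM; case: a => [[[v x]|e] b].
  exists n.+1; apply: (@word_vertex _ v) wn; case: b; last by exists x.
  by rewrite -[[:: _]]/(winv [:: gen_v x]) wclassV; apply: vsubV; exists x.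
have -> : wclass (@pi1_rel X GG ET) [:: (inr e, b)] =
    edg (if b then rev_edge e else e).
  by case: b => //; rewrite eincl_rev -eincl_inv.
move: (if b then _ else _) => {e b} e.
have [Te|Se] := pselect (ET e); first by exists n; rewrite eincl_tree // mul1g.
by exists n.+1; exact: word_edge.
Qed.

(** * Pushing an element of a vertex group through the tree *)

(** The element x is stuck on its way to u: the set attached to u, or to an edge
outside the tree that starts at u, is sent by x into X_(o(e)). *)
Definition leaves_toward u (x : G) : Prop :=
  exists e, [/\ ET e, beyond ET e u, vsub (org e) x & ~ esub e x].

(** As long as x belongs to the group of the next edge e of the tree, the
relation of e, in which e is trivial, makes it an element of the next vertex
group. *)
Lemma push_geodesic v e p u x : geodesic ET v (e :: p) u -> vsub v x ->
  leaves_toward u x \/ esub (last e p) x.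
Proof.
elim: p v e => [|f p IHp] v e geo vx.
all: have [[Te eu _] _] := geo; rewrite -eu in geo vx.
all: have [ex|nex] := pselect (esub e x); last first.
- by left; exists e; split=> //; exists [:: e]; rewrite ?mem_head.
- by right.
- by left; exists e; split=> //; exists [:: e, f & p]; rewrite ?mem_head.
apply: (IHp _ _ (geodesic_behead geo)).
exact: esub_vsub (esub_tree Te ex).
Qed.

Lemma push_vertex v u x : vsub v x -> leaves_toward u x \/ vsub u x.
Proof.
move=> vx; have [[|e p] geo] := geodesic_exists v u conT.
  by right; have [<-] := geo.
have [|ex] := push_geodesic geo vx; [by left | right].
have [Te <-] := epath_last geo.1.
exact: esub_vsub (esub_tree Te ex).
Qed.

(** Along the reversed geodesic, which ends with the reverse of f. *)
Lemma push_edge f w x : ET f -> beyond ET f w -> vsub w x ->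
  leaves_toward (org f) x \/ esub f x.
Proof.
move=> Tf [p geo fp] wx; have [q pE] := geodesic_head geo fp.
have := geodesic_rev symT geo; rewrite {}pE map_cons rev_cons.
case E: (rcons _ _) => [|e r]; first by case: (rev _) E.
have lastE : last e r = rev_edge f by rewrite -(last_cons f) -E last_rcons.
move=> {}geo; have := push_geodesic geo wx; rewrite lastE.
by case; [left | move=> /(esub_tree (symT Tf)); rewrite rev_edgeK; right].
Qed.

(** * Normal forms *)

(** The members X_v and Z_s of an interactive family as formal symbols; they
record where the factors of a product have led, even if X_v is empty. *)
Inductive state := SX of vertex X | SZ of edge X.

Definition loc O := match O with SX v => v | SZ s => org s end.

(** The edge e at its origin leads to O: this is what (IF4), (IF7) and (IF8)
require of e, for the elements of G_(o(e)) outside its edge group to map the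
set O into X_(o(e)). *)
Definition facing e O : Prop := (ET e /\ beyond ET e (loc O)) \/ O = SZ e.

(** Products of n factors that lead from the state B to another state, the factor
applied last being the leftmost one. *)
Inductive reduced (B : state) : nat -> state -> G -> Prop :=
| reduced_base : reduced B 0 B 1
| reduced_vertex n O g e x : reduced B n O g -> facing e O ->
    vsub (org e) x -> ~ esub e x -> reduced B n.+1 (SX (org e)) (x * g)
| reduced_edge n O g s : reduced B n O g -> ~ ET s -> O <> SZ (rev_edge s) ->
    reduced B n.+1 (SZ s) (edg s * g).

Lemma reduced_word B n O g : reduced B n O g -> word n g.
Proof.
elim=> [|k O' h e x _ IH _ ex _|k O' h s _ IH Ss _]; first exact: word_nil.
  exact: word_vertex ex IH.
exact: word_edge.
Qed.

Lemma reduced_leaves B m O k u x : reduced B m O k -> u = loc O ->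
  leaves_toward u x -> exists v, reduced B m.+1 (SX v) (x * k).
Proof.
move=> red -> [e [Te be vx nex]]; exists (org e).
by apply: reduced_vertex red _ vx nex; left.
Qed.

Definition stab B : set G := match B with SX v => vsub v | SZ s => esub s end.

Lemma stab1 B : stab B 1.
Proof. by case: B => [v|s]; [exact: vsub1 | exact: esub1]. Qed.

Lemma stabM B x y : stab B x -> stab B y -> stab B (x * y).
Proof. by case: B => [v|s]; [exact: vsubM | exact: esubM]. Qed.

Lemma stab_word B h : stab B h -> word 1%N h.
Proof.
by case: B => [v|s]; [exact: word_vsub | move=> /esub_vsub; exact: word_vsub].
Qed.

(** The words ending in s are measured by length: j.+1 <= n is the length of the
word obtained for g. *)
Definition ends_in s n (g : G) : Prop :=
  exists j k, [/\ word j k, j < n & g = k * edg s].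

(** The factor h, when not trivial, counts for 1 in the length n.  The second
alternative is the obstruction at Z_r, whose reverse edge is the one letter
that cannot be applied to it.  It is stable under multiplication on the left
by generators. *)
Definition normal_form B n (g : G) : Prop :=
  (exists m O k h, [/\ reduced B m O k, stab B h, g = k * h &
     m < n \/ m <= n /\ h = 1]) \/
  exists2 r, B = SZ r & ends_in (rev_edge r) n g.

Lemma normal_form_le B m n g :
  m <= n -> normal_form B m g -> normal_form B n g.
Proof.
move=> mn [[k [O [g' [h [red sh -> lt]]]]]|[r Br [j [k [wk jm ->]]]]].
  left; exists k, O, g', h; split=> //; case: lt => [km|[km ->]].
    by left; exact: leq_trans mn.
  by right; split=> //; exact: leq_trans mn.
by right; exists r => //; exists j, k; split=> //; exact: leq_trans mn.
Qed.

Lemma edg_esub s h : esub (rev_edge s) h ->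
  exists2 y, esub s y & edg s * h = y * edg s.
Proof.
move=> /esub_edge[y]; rewrite rev_edgeK eincl_rev => sy hy; exists y => //.
by apply: (mulgI (edg s)^-1); rewrite mulKg mulgA -hy mulgVK.
Qed.

Lemma normal_form_edge B n g s :
  ~ ET s -> normal_form B n g -> normal_form B n.+1 (edg s * g).
Proof.
move=> Ss [[m [O [k [h [red sh -> lt]]]]]|]; last first.
  move=> [r Br [j [k [wk jn ->]]]].
  right; exists r => //; exists j.+1, (edg s * k).
  by split; rewrite ?mulgA //; exact: word_edge.
have [Os|nOs] := pselect (O = SZ (rev_edge s)); last first.
  left; exists m.+1, (SZ s), (edg s * k), h; split; rewrite ?mulgA //.
  exact: reduced_edge red Ss nOs.
case: red Os lt => [Bs|//|m' O' k' t red St Ot [ts]] lt.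
  right; exists (rev_edge s) => //; rewrite rev_edgeK mul1g.
  (* No reduced factor is left, and the new letter meets the initial state. *)
  case: lt => [n_gt0|[_ ->]]; last first.
    by exists 0, 1; split; [exact: word_nil | | rewrite mulg1 mul1g].
  move: sh; rewrite Bs => /edg_esub[y sy ->].
  by exists 1%N, y; split; [exact: word_vsub (esub_vsub sy) | |].
(* The new letter cancels with the leftmost factor. *)
left; exists m', O', k', h; split=> //.
  by rewrite ts eincl_rev !mulgA mulgV mul1g.
by case: lt => [/ltnW/ltnW|[/ltnW/leqW mn ->]]; [left | right].
Qed.

Lemma normal_form_stab B n g h :
  normal_form B n g -> stab B h -> normal_form B n.+1 (g * h).
Proof.
move=> [[m [O [k [h' [red sh' -> lt]]]]] sh|[r Br [j [k [wk jn ->]]]]].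
  left; exists m, O, k, (h' * h); split; rewrite ?mulgA //; first exact: stabM.
  by left; case: lt => [/ltnW//|[]].
rewrite Br -{1}(rev_edgeK r) => /edg_esub[y ry hy].
right; exists r => //; exists (j + 1)%N, (k * y).
split; [|by rewrite addn1|by rewrite -!mulgA hy].
exact: word_cat wk (word_vsub (esub_vsub ry)).
Qed.

Lemma normal_form_reduced B m O k : reduced B m O k -> normal_form B m k.
Proof.
move=> red; left; exists m, O, k, 1.
by split; rewrite ?mulg1 //; [exact: stab1 | right].
Qed.

(** The factor x is pushed to the location of the last state.  If it arrives
there, it merges with the leftmost factor when that one is in a vertex group,
or stops before the leftmost factor s, or crosses s; in the first and the last
case the remaining product is shorter, and induction applies. *)
Lemma reduced_mull B m O k v x :
  reduced B m O k -> vsub v x -> normal_form B m.+1 (x * k).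
Proof.
move=> red; elim: red v x => {m O k}
  [|m O k e y red IH Oe ey ney|m O k s red IH Ss nO] v x vx.
- have [lx|] := push_vertex (loc B) vx.
    have [w redx] := reduced_leaves (reduced_base B) erefl lx.
    exact: normal_form_reduced redx.
  have stabx : stab B x -> normal_form B 1%N (x * 1).
    move=> sx; rewrite mulg1 -[x]mul1g; apply: normal_form_stab sx.
    exact/normal_form_reduced/reduced_base.
  case: B stabx => [u|r] stabx rx; first exact: stabx.
  have [ex|nex] := pselect (esub r x); first exact: stabx.
  apply/normal_form_reduced; apply: reduced_vertex rx nex.
    exact: reduced_base.
  by right.
- have redy : reduced B m.+1 (SX (org e)) (y * k).
    exact: reduced_vertex red Oe ey ney.
  have [lx|ex] := push_vertex (org e) vx.
    have [w redx] := reduced_leaves redy erefl lx.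
    exact: normal_form_reduced redx.
  rewrite mulgA; apply: (@normal_form_le _ m.+1) => //.
  exact: IH (vsubM ex ey).
- have reds : reduced B m.+1 (SZ s) (edg s * k).
    exact: reduced_edge red Ss nO.
  have [lx|sx] := push_vertex (org s) vx.
    have [w redx] := reduced_leaves reds erefl lx.
    exact: normal_form_reduced redx.
  have [ex|nex] := pselect (esub s x); last first.
    by apply/normal_form_reduced; apply: reduced_vertex reds _ sx nex; right.
  have [y ry xy] := esub_edge ex.
  rewrite mulgA xy -mulgA; apply: normal_form_edge => //.
  exact: IH (esub_vsub ry).
Qed.

Lemma normal_form_vertex B n g v x :
  vsub v x -> normal_form B n g -> normal_form B n.+1 (x * g).
Proof.
move=> vx [[m [O [k [h [red sh -> lt]]]]]|[r Br [j [k [wk jn ->]]]]].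
  rewrite mulgA; have NFx := reduced_mull red vx.
  case: lt => [mn|[mn ->]].
    by apply: (@normal_form_le _ m.+2) => //; exact: normal_form_stab.
  by rewrite mulg1; apply: (@normal_form_le _ m.+1).
right; exists r => //; exists j.+1, (x * k).
by split; rewrite ?mulgA //; exact: word_vertex vx wk.
Qed.

Lemma word_normal_form B n g : word n g -> normal_form B n g.
Proof.
elim=> [|m v x h vx _ IH|m s h Ss _ IH].
- exact/normal_form_reduced/reduced_base.
- exact: normal_form_vertex vx IH.
- exact: normal_form_edge.
Qed.

(** * Dynamics of an interactive family *)

Section Dynamics.
Variables (Omega : Type) (rho : left_action G Omega).
Variables (Xv : vertex X -> set Omega) (Z Xe : edge X -> set Omega).
Hypothesis hIF : interactive rho Xv Z Xe.

(** The condition on s makes a point of the cell of a state witness that the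
state is meaningful. *)
Definition cell O : set Omega :=
  match O with SX v => Xv v | SZ s => [set x | ~ ET s /\ Z s x] end.

Lemma cell_inj O O' x : cell O x -> cell O' x -> O = O'.
Proof.
case: O O' => [v|s] [w|t] /=.
- by move=> vx wx; congr SX; apply: (IF1_XX hIF) => //; exists x.
- by move=> vx [St tx]; have := IF1_XZ hIF v St; move/seteqP => [/(_ x)[]].
- by move=> [Ss sx] wx; have := IF1_XZ hIF w Ss; move/seteqP => [/(_ x)[]].
- by move=> [Ss sx] [St tx]; congr SZ; apply: (IF1_ZZ hIF) => //; exists x.
Qed.

Lemma cell_nonempty s : ~ ET s -> exists x, cell (SZ s) x.
Proof. by move=> Ss; have [x sx] := IF1_Z hIF Ss; exists x. Qed.

Lemma not_esub e x : vsub (org e) x -> ~ esub e x ->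
  exists2 g, ~ (@ealpha X GG e) g & x = vincl ET g.
Proof.
move=> [g _ <-] ne; exists g => // -[a _ ga].
by apply: ne; exists g => //; exists a.
Qed.

Lemma not_esub_eproper e x : vsub (org e) x -> ~ esub e x -> eproper GG e.
Proof. by move=> ex /(not_esub ex)[g ng _] eT; apply: ng; rewrite -eT. Qed.

Lemma facing_images e O x q : facing e O -> vsub (org e) x -> ~ esub e x ->
  cell O q -> if_images rho Xv Z (org e) (rho x q).
Proof.
move=> Oe ex /(not_esub ex)[g ng ->] Oq.
have mv (Y : set Omega) : Y q ->
    vmove rho (~` @ealpha X GG e) Y (rho (vincl ET g) q).
  by move=> Yq; exists g => //; exists q.
case: Oe Oq => [[Te be]|->]; last first.
  by move=> [Ss sq]; left; exists e; split=> //; exact: mv.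
case: O be => [v|s] /= be => [vq|[Ss sq]].
  by right; left; exists e, v; split=> //; exact: mv.
by right; right; exists e, s; split=> //; exact: mv.
Qed.

Lemma vmove_eproper e Y y :
  vmove rho (~` @ealpha X GG e) Y y -> eproper GG e.
Proof. by move=> [g ng _] eT; apply: ng; rewrite -eT. Qed.

Lemma images_Xv w : if_images rho Xv Z w `<=` Xv w.
Proof.
move=> y [[s [Ss <-]]|[[e [v [Te <- be]]]|[e [s [Te <- Ss be]]]]] my.
- exact: (IF4 hIF Ss) my.
- have pe := vmove_eproper my; have [_] := IF5 hIF Te pe; apply.
  exact: (IF7 hIF Te pe be) my.
- have pe := vmove_eproper my; have [_] := IF5 hIF Te pe; apply.
  exact: (IF8 hIF Te pe Ss be) my.
Qed.

Lemma edge_cell s O q : ~ ET s -> O <> SZ (rev_edge s) -> cell O q ->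
  cell (SZ s) (rho (edg s) q).
Proof.
move=> Ss nO Oq; split=> //; case: O nO Oq => [v _ vq|r nr [Sr rq]].
  by apply: (IF2_X hIF Ss (v := v)); exists q.
apply: (IF2_Z hIF Ss Sr); last by exists q.
by move=> rs; apply: nr; rewrite rs.
Qed.

Lemma stab_cell s h q : esub s h -> cell (SZ s) q -> cell (SZ s) (rho h q).
Proof.
move=> [g sg <-] [Ss sq]; split=> //; apply: (IF3 hIF Ss).
by exists g => //; exists q.
Qed.

(** The ping-pong lemma.  If the last state is X_w, the last factor is in G_w, so
that the point arrives in one of the images of (IF10) and not only in X_w. *)
Lemma reduced_images B n O k q : reduced B n O k -> cell B q ->
  cell O (rho k q) /\
  (0 < n -> forall w, O = SX w -> if_images rho Xv Z w (rho k q)).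
Proof.
move=> red Bq; elim: red => {n O k}
  [|n O k e x _ [Oq _] Oe ex nex|n O k s _ [Oq _] Ss nO].
- by rewrite lact1.
- rewrite lactM; have im := facing_images Oe ex nex Oq.
  by split=> [|_ w [<-]] //; exact: images_Xv.
- by rewrite lactM; split=> //; exact: edge_cell nO Oq.
Qed.

Lemma reduced_cell B n O k q : reduced B n O k -> cell B q -> cell O (rho k q).
Proof. by move=> red /(reduced_images red)[]. Qed.

End Dynamics.

(** * Elements acting trivially *)

Section Kernel.
Variables (Omega : Type) (rho : left_action G Omega).
Variables (Xv : vertex X -> set Omega) (Z Xe : edge X -> set Omega).
Hypothesis hIF : proper_interactive rho Xv Z Xe.
Let hI := proper_IF hIF.
Local Notation cell := (cell Xv Z).

Definition kernel (g : G) : Prop := forall x, rho g x = x.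

Lemma kernelV g : kernel g -> kernel g^-1.
Proof. by move=> gK x; rewrite -[in LHS](gK x) -lactM mulVg lact1. Qed.

Lemma kernelJ g h : kernel g -> kernel (g ^ h).
Proof. by move=> gK x; rewrite conjgE !lactM gK -lactM mulVg lact1. Qed.

(** A point of Z_s works if O is another state.  If O is Z_s itself, any point of
a set of the family other than Z_s and the set of the reverse of s works, and
if there is none, the hypotheses of (IF11) hold. *)
Lemma escape_point s O : ~ ET s ->
  exists2 q, ~ cell O q & cell (SZ s) (rho (edg s) q).
Proof.
move=> Ss; have SVs := rev_notin_tree Ss.
have [Os|nO] := pselect (O = SZ s); last first.
  have [q sq] := cell_nonempty hI Ss; exists q.
    by move=> Oq; apply/nO/(cell_inj hI Oq sq).
  apply: (edge_cell hI Ss _ sq) => -[/eqP].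
  by rewrite eq_sym (negPf (rev_edge_neq s)).
have [[O' [q [O's O'Vs O'q]]]|none] := pselect
    (exists O' q, [/\ O' <> SZ s, O' <> SZ (rev_edge s) & cell O' q]).
  exists q; first by move=> Oq; apply: O's; rewrite -Os; exact: (cell_inj hI) Oq.
  exact: (edge_cell hI Ss O'Vs O'q).
have Spair : ~` ET = [set s; rev_edge s].
  apply/seteqP; split=> [r Sr|r /= [->|->]] //.
  have [q rq] := cell_nonempty hI Sr; apply: contrapT => /not_orP[rs rVs].
  by apply: none; exists (SZ r), q; split=> // -[].
have Xv0 v : Xv v = set0.
  by apply/seteqP; split=> // q vq; apply: none; exists (SX v), q.
have [q [nsq _ sq _]] := IF11 hIF Spair Xv0.
by exists q; [rewrite Os => -[] | split].
Qed.

(** In g = k s with k = k' h in normal form relative to Z_s, all the points of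
the preimage of Z_s under s go to the cell of one state O under g; but not all
of them lie in that cell.  The obstruction does not occur, for s would cancel
with the last letter of k. *)
Lemma minimal_kernel_not_ends_in g n s : kernel g ->
  (forall m, word m g -> n <= m) -> ~ ET s -> ~ ends_in s n g.
Proof.
move=> gK min_n Ss [j [k [wk jn gE]]].
have [[m [O [k' [h [red sh kE _]]]]]|] := word_normal_form (SZ s) wk.
  have [q nOq sq] := escape_point O Ss; apply: nOq.
  rewrite -(gK q) gE kE !lactM; apply: (reduced_cell hI red).
  exact: (stab_cell hI sh sq).
move=> [_ [<-] [i [k' [wk' ij kE]]]].
suff /min_n : word i g by rewrite leqNgt (ltn_trans ij jn).
by rewrite gE kE eincl_rev mulgVK.
Qed.

Lemma esub_kernel e g (Y : set Omega) :
  faithful_on rho (@ealpha X GG e) Y ->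
  esub e g -> kernel g -> g = 1.
Proof. by move=> faith [x ex <-] gK; rewrite (faith x ex) ?vincl1 // => y _. Qed.

(** Relative to Z_s, the normal form of a word of minimal length for g sends Z_s
into one cell, which must be Z_s.  So it has no factor, or its leftmost factor
is s and then the inverse of g ends in the reverse of s. *)
Lemma kernel_edge s g : ~ ET s -> kernel g -> g = 1.
Proof.
move=> Ss gK.
have [n wn min_n] := minimal_nat (word_exists g).
have not_ends r : ~ ET r -> ~ ends_in r n g.
  exact: minimal_kernel_not_ends_in.
have [[m [O [k [h [red sh gE lt]]]]]|] := word_normal_form (SZ s) wn; last first.
  by move=> [_ [<-] /not_ends[]]; exact: rev_notin_tree.
have [q sq] := cell_nonempty hI Ss.
have Os : O = SZ s.
  apply: (cell_inj hI _ sq); rewrite -(gK q) gE lactM.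
  by apply: (reduced_cell hI red); exact: (stab_cell hI sh sq).
case: red Os gE lt => {m O k} [_|//|m O k t red St _ [->]] gE lt.
  rewrite gE mul1g; apply: (esub_kernel (IF9_Z hIF Ss) sh).
  by rewrite gE mul1g in gK.
have [j [wj jn]] : exists j, word j (k * h) /\ j < n.
  have wk := reduced_word red.
  case: lt => [mn|[mn ->]]; last by exists m; rewrite mulg1.
  by exists m.+1; split=> //; rewrite -addn1; exact: word_cat (stab_word sh).
exfalso.
apply: (minimal_kernel_not_ends_in (kernelV gK) (s := rev_edge s) (n := n)).
- by move=> i /word_inv; rewrite invgK; exact: min_n.
- exact: rev_notin_tree.
exists j, (k * h)^-1; split=> //; first exact: word_inv.
by rewrite eincl_rev -invgM gE mulgA.
Qed.

Hypothesis treeT : ET = setT.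

(** If no element of a vertex group can get stuck on its way to w, all the vertex
groups are contained in G_w. *)
Lemma tree_generated w :
  (forall e x, ET e -> beyond ET e w -> vsub (org e) x -> esub e x) ->
  vsub w = setT.
Proof.
move=> surj; apply/seteqP; split=> // g _.
have [n] := word_exists g; elim=> [|m v x h vx _ IH|m s h Ss _ IH].
- exact: vsub1.
- apply: vsubM IH; case: (push_vertex w vx) => [[e [Te be ex []]]|//].
  exact: surj.
- by case: Ss; rewrite treeT.
Qed.

Hypothesis nontrivial : ~ trivial_splitting GG ET.

Lemma proper_edge_toward w : exists f, [/\ ET f, beyond ET f w & eproper GG f].
Proof.
apply: contrapT => none; apply: nontrivial; split=> //; exists w.
apply: tree_generated => e x Te be ex; apply: contrapT => nex; apply: none.
by exists e; split=> //; exact: not_esub_eproper nex.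
Qed.

(** Stuck on its way to o(f), the element would send the non-empty set X_(o(f))
into another set of the family. *)
Lemma kernel_vertex w g : vsub w g -> kernel g -> g = 1.
Proof.
move=> wg gK; have [f [Tf bf pf]] := proper_edge_toward w.
have [[e [Te be eg neg]]|fg] := push_edge Tf bf wg; last first.
  exact: (esub_kernel (IF9_X hIF Tf pf)) fg gK.
have [q fq] := IF1_X hI pf.
have Oe : facing e (SX (org f)) by left.
have := images_Xv hI (facing_images rho Oe eg neg (fq : cell (SX _) q)).
rewrite gK => eq; have := cell_inj hI (eq : cell (SX _) q) (fq : cell (SX _) q).
by move=> [ef]; case: (beyond_neq be).
Qed.

(** A conjugate of minimal length is k h in normal form relative to X_w.  If h is
trivial, k has no factor, as it would move p.  Otherwise conjugate further, to
h k.  If h gets stuck on its way to the leftmost factor of k, then h k is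
reduced and moves p; if not, h merges with that factor and the length drops. *)
Lemma kernel_conj_vertex : exists w, forall g, kernel g ->
  exists2 h, vsub w h & exists k, h = g ^ k.
Proof.
have [v] := conT.1; have [f [_ _ /(IF1_X hI) Xf0]] := proper_edge_toward v.
have [|w [p [wp nimp]]] := IF10 hIF; first by exists (org f).
exists w => g gK.
have not_reduced m O k : reduced (SX w) m.+1 O k -> ~ kernel k.
  move=> red kK; have [Ok im] := reduced_images hI red wp.
  apply/nimp; rewrite -(kK p); apply: im => //; rewrite kK in Ok.
  exact: (cell_inj hI Ok (wp : cell (SX w) p)).
have [n [k0 wn] min_n] := minimal_nat (P := fun n => exists k, word n (g ^ k))
  (let: ex_intro n wn := word_exists (g ^ 1) in ex_intro _ n (ex_intro _ 1 wn)).
have gjK := kernelJ k0 gK.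
have [[m [O [k [h [red sh gE lt]]]]]|[? //]] := word_normal_form (SX w) wn.
case: red gE lt => {m O k} [|m O k e x red Oe ex nex|m O k s _ Ss] gE lt.
- by exists (g ^ k0); [rewrite gE mul1g | exists k0].
- have redx := reduced_vertex red Oe ex nex.
  case: lt => [mn|[_ h1]]; last first.
    by case: (not_reduced _ _ _ redx); rewrite gE h1 mulg1 in gjK.
  have hgE : h * (x * k) = g ^ (k0 * h^-1).
    by rewrite conjgM gE conjgE invgK !mulgA mulgK.
  have [lh|eh] := push_vertex (org e) (sh : vsub w h).
    have [v' /not_reduced[]] := reduced_leaves redx erefl lh.
    by rewrite hgE; exact: kernelJ.
  have /min_n : exists k1, word m.+1 (g ^ k1).
    exists (k0 * h^-1); rewrite -hgE mulgA.
    exact: word_vertex (vsubM eh ex) (reduced_word red).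
  by rewrite leqNgt mn.
- by case: Ss; rewrite treeT.
Qed.

Lemma kernel_tree g : kernel g -> g = 1.
Proof.
move=> gK; have [w /(_ g gK)[h wh [k hE]]] := kernel_conj_vertex.
have := kernel_vertex wh; rewrite hE => /(_ (kernelJ k gK)) /eqP.
by rewrite conjg_eq1 => /eqP.
Qed.

End Kernel.
End NormalForms.

Theorem theorem5p4 (X : graph) (GG : graph_of_groups X) (ET : set (edge X))
    (hX : @connected_graph X setT) (hT : spanning_tree ET)
    (hG : ~ trivial_splitting GG ET)
    (Omega : Type) (rho : left_action (pi1 GG ET) Omega)
    (Xv : vertex X -> set Omega) (Z Xe : edge X -> set Omega)
    (hIF : proper_interactive rho Xv Z Xe) :
  faithful_action rho.
Proof.
have [symT conT _] := hT; move=> g gK.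
have [[s Ss]|S0] := pselect (exists s, ~ ET s).
  exact: (kernel_edge symT conT hIF Ss gK).
have treeT : ET = setT.
  by apply/seteqP; split=> // e _; apply: contrapT => Se; apply: S0; exists e.
exact: (kernel_tree symT conT hIF treeT hG gK).
Qed.
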